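(* Let $p$ be an odd prime. For every non-negative integer $n$, $$v_p\left(\epsilon_{n(p-1)/2}\right)=-n.$$
   Context: The sequence of rational numbers $\{\epsilon_i\}_{i=0}^\infty$ is defined by $\epsilon_0=1$ and, inductively for each integer $l\ge 1$, by $$\frac{1}{(2l+1)!}=\sum_{i=1}^l\ \sum_{\substack{j_1+\cdots+j_i=l\\ j_1,\dots,j_i\ge 1}}\frac{2^i\epsilon_i}{(2j_1)!\cdots(2j_i)!}.$$ Equivalently, it is the unique sequence satisfying $$\sum_{l=0}^\infty\frac{x^l}{(2l+1)!}=\sum_{i=0}^\infty\epsilon_i\left(\sum_{j=1}^\infty\frac{2x^j}{(2j)!}\right)^i$$ in the ring of formal power series $\mathbb{Q}[[x]]$. For a prime $p$ and a rational number $q$, $v_p(q)$ denotes the $p$-adic valuation of $q$: if $q=p^at/(p^bs)$ with $s,t$ integers prime to $p$, then $v_p(q)=a-b$. *)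

(* Defs.v *)
From HB Require Import structures.
From mathcomp Require Import all_boot all_order all_algebra.
Set Implicit Arguments. Unset Strict Implicit. Unset Printing Implicit Defensive.
Import Order.TTheory GRing.Theory Num.Theory.
Local Open Scope ring_scope.

(* The compositions j_1 + ... + j_i = l with all j_k >= 1 are the functions
   j : 'I_i -> {0, ..., l} selected by the filter; no part exceeds l, so
   restricting the codomain loses nothing. *)
Definition composition (i l : nat) (j : {ffun 'I_i -> 'I_l.+1}) : bool :=
  [forall k, (0 < j k)%N] && (\sum_(k < i) (j k : nat) == l)%N.

Definition epsilon_seq (eps : nat -> rat) : Prop :=
  eps 0%N = 1 /\
  forall l : nat, (1 <= l)%N ->
    1 / ((2 * l + 1)`!)%N%:R =
    \sum_(1 <= i < l.+1)
      \sum_(j : {ffun 'I_i -> 'I_l.+1} | composition j)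
        (2 ^+ i * eps i) / (\prod_(k < i) ((2 * j k)`!)%N%:R).

(* p-adic valuation of a rational number, read off its reduced fraction.
   Junk value: padic_val p 0 = 0. *)
Definition padic_val (p : nat) (q : rat) : int :=
  (logn p `|numq q|)%:Z - (logn p `|denq q|)%:Z.

Lemma padic_valE (p a b : nat) (t s : int) : prime p ->
  coprimez p t -> coprimez p s ->
  padic_val p ((p%:R ^+ a * t%:~R) / (p%:R ^+ b * s%:~R)) = a%:Z - b%:Z.
Proof.
move=> pp ct cs; have p0 : p != 0%N by rewrite -lt0n prime_gt0.
have nz u : coprimez p u -> u != 0.
  move=> cu; apply/eqP => u0; move: cu; rewrite u0 coprimezE /= /coprime gcdn0.
  by move/eqP=> p1; move: pp; rewrite p1.
have lg u c : coprimez p u -> logn p (p ^ c * `|u|)%N = c.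
  move=> cu; have u0 : (0 < `|u|)%N by rewrite absz_gt0 nz.
  have pc0 : (0 < p ^ c)%N by rewrite expn_gt0 prime_gt0.
  by rewrite lognM // pfactorK // logn_coprime ?addn0.
set q := _ / _.
have ne : (p%:R ^+ b * s%:~R : rat) != 0.
  by rewrite mulf_neq0 ?expf_neq0 ?pnatr_eq0 ?intr_eq0 ?nz.
have q0 : q != 0.
  by rewrite mulf_neq0 ?invr_eq0 // mulf_neq0 ?expf_neq0 ?pnatr_eq0 ?intr_eq0 ?nz.
have E : numq q * (p%:Z ^+ b * s) = (p%:Z ^+ a * t) * denq q.
  apply/eqP; rewrite -(eqr_int rat) !rmorphM !rmorphXn /= -!pmulrn.
  by rewrite -eqr_div ?intr_eq0 ?denq_neq0 // divq_num_den /q.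
have := congr1 (fun x : int => logn p `|x|) E.
have pos u c : coprimez p u -> (0 < p ^ c * `|u|)%N.
  by move=> cu; rewrite muln_gt0 expn_gt0 prime_gt0 // absz_gt0 nz.
rewrite /= !abszM !abszX /= (@lognM p `|numq q|) ?pos ?absz_gt0 ?numq_eq0 //.
rewrite (@lognM p _ `|denq q|) ?pos ?absz_gt0 ?denq_neq0 //.
rewrite !lg // /padic_val => H.
apply/eqP; rewrite subr_eq addrAC eq_sym subr_eq -!PoszD eqz_nat; apply/eqP.
by rewrite H.
Qed.

Lemma epsilon_seq_top (l : nat) (x : rat) :
  \sum_(j : {ffun 'I_l -> 'I_l.+1} | composition j)
     (2 ^+ l * x) / (\prod_(k < l) ((2 * j k)`!)%N%:R) = x.
Proof.
case: l => [|l].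
  rewrite (big_pred1 [ffun=> ord0]) => [|j]; first by rewrite big_ord0 expr0 mul1r divr1.
  rewrite /composition big_ord0 eqxx andbT.
  have -> : [forall k, (0 < j k)%N] by apply/forallP=> -[].
  by symmetry; apply/eqP/ffunP=> -[].
have d1 : (1 < l.+2)%N by [].
rewrite (big_pred1 [ffun=> Ordinal d1]) => [|j].
  rewrite (eq_bigr (fun=> 2)) => [|k _]; last by rewrite ffunE.
  rewrite prodr_const card_ord mulrC mulrA mulVf ?mul1r //.
  by rewrite expf_neq0.
apply/idP/eqP => [/andP[/forallP jp /eqP js]|->]; last first.
  apply/andP; split; first by apply/forallP=> k; rewrite ffunE.
  by rewrite (eq_bigr (fun=> 1%N)) ?sum1_card ?card_ord // => k _; rewrite ffunE.
have z : (\sum_(k < l.+1) (j k - 1) = 0)%N.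
  apply/eqP; rewrite -(eqn_add2r l.+1) add0n -[X in (_ + X)%N]card_ord -sum1_card.
  by rewrite -big_split /= -[X in _ == X]js; apply/eqP/eq_bigr=> k _; rewrite subnK.
apply/ffunP=> k; rewrite ffunE; apply/val_inj => /=; apply/eqP.
rewrite eqn_leq jp andbT -subn_eq0.
by move/eqP: z; rewrite sum_nat_eq0 => /forallP/(_ k).
Qed.

Lemma epsilon_seq_exists : exists eps, epsilon_seq eps.
Proof.
pose step (s : seq rat) : rat := let l := size s in
  if l == 0%N then 1 else
  1 / ((2 * l + 1)`!)%N%:R -
    \sum_(1 <= i < l) \sum_(j : {ffun 'I_i -> 'I_l.+1} | composition j)
        (2 ^+ i * s`_i) / (\prod_(k < i) ((2 * j k)`!)%N%:R).
pose pre n := iter n (fun s => rcons s (step s)) [::].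
have sz n : size (pre n) = n by elim: n => //= n IH; rewrite size_rcons IH.
have nthp n i : (i < n)%N -> (pre n)`_i = step (pre i).
  elim: n => //= n IH; rewrite ltnS leq_eqVlt nth_rcons sz.
  by case/orP=> [/eqP->|lt]; rewrite ?ltnn ?eqxx // lt IH.
exists (fun n => step (pre n)); split=> // l l1.
rewrite big_nat_recr //= epsilon_seq_top [step (pre l)]/step sz.
rewrite (gtn_eqF l1) addrC.
under [X in _ - X]eq_big_nat => i /andP[_ il] do under eq_bigr do rewrite nthp //.
by rewrite subrK.
Qed.

Lemma epsilon_seq_unique (e f : nat -> rat) :
  epsilon_seq e -> epsilon_seq f -> e =1 f.
Proof.
move=> [e0 er] [f0 fr] n; elim/ltn_ind: n => -[|n] IH; first by rewrite e0 f0.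
have := er n.+1 isT; rewrite (fr n.+1 isT).
rewrite !(@big_nat_recr _ _ _ n.+1 1) //= !epsilon_seq_top.
under eq_big_nat => i /andP[_ il] do under eq_bigr do rewrite -IH //.
by move/addrI.
Qed.

(* Main.v *)
Require Import Defs.
From HB Require Import structures.
From mathcomp Require Import all_boot all_order all_algebra.
From mathcomp Require Import ring zify.
Import Order.TTheory GRing.Theory Num.Theory.
Local Open Scope ring_scope.

(** With x = t^2, put Y = 2 cosh t - 2 and S = sinh t / t.  The recursion that
    defines epsilon says S = E(Y), where E is the generating series of epsilon.
    The reciprocal of E is explicit:
      1 / E(y) = sum_k b_k y^k,   b_k = (-1)^k k!^2 / (2k+1)!
    (the expansion of arcsinh z / (z sqrt(1 + z^2)) at y = 4 z^2), so that
      epsilon_N = - sum_(1 <= k <= N) b_k epsilon_(N-k)   for N >= 1.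

    The reciprocal is found from differential equations.  In the variable x one
    has Y' = S, 2 S + 4 x S' = 2 + Y and 4 x S^2 = 4 Y + Y^2, while the relation
    (4k+6) b_(k+1) = -(k+1) b_k says that B = sum_k b_k y^k satisfies
    (4y + y^2) B' + (2 + y) B = 2.  Together they give 4 x W' + 2 W = 2 for
    W = B(Y) S, hence W = 1.  As Y has order exactly 1 in x, (B E)(Y) = 1
    implies B E = 1 (inv_eps_conv).  Power series are handled as polynomials modulo X^M.

    Now let p = 2m+1.  By Legendre's formula, the order of the pole of b_k at p
    is at most the largest e with p^e <= 2k+1, and p^e >= 1 + e(p-1) with
    equality only for e <= 1.  So b_k has a pole of order at most
    floor((k-1)/m) for every k >= 1 other than m (pole_le_inv_coef_off), while b_m
    has a simple pole (pole_eq_inv_coef_half).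
    In the recursion for epsilon_(nm), the terms with k <> m thus have poles of
    order at most n-1, and by induction the term k = m has a pole of order
    exactly n, so it alone decides the valuation. *)

(** * Coefficients of powers and compositions of polynomials *)

Lemma coef_exp_trunc (R : comNzRingType) (P Q : {poly R}) (l : nat) :
  (forall k, (k <= l)%N -> P`_k = Q`_k) ->
  forall i k, (k <= l)%N -> (P ^+ i)`_k = (Q ^+ i)`_k.
Proof.
move=> PQ; elim=> [|i IH] k kl; first by rewrite !expr0.
rewrite !exprS !coefM; apply: eq_bigr => j _.
by rewrite PQ ?IH //; have := ltn_ord j; lia.
Qed.

(** Expand the power by distributivity, with the base cut off after degree l so
    that the index of each factor runs over 'I_l.+1; as the constant term is 0,
    only functions with positive values contribute. *)
Lemma coef_exp_composition (R : comNzRingType) (P : {poly R}) (i l : nat) :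
  P`_0 = 0 ->
  (P ^+ i)`_l =
  \sum_(j : {ffun 'I_i -> 'I_l.+1} | composition j) \prod_(k < i) P`_(j k).
Proof.
move=> P0.
rewrite (@coef_exp_trunc R P (\poly_(j < l.+1) P`_j) l) //; last first.
  by move=> k kl; rewrite coef_poly ltnS kl.
rewrite poly_def -[X in _ ^+ X]card_ord -prodr_const bigA_distr_bigA /= coef_sum.
rewrite [LHS](bigID (@composition i l)) /= [X in _ + X]big1 ?addr0.
  apply: eq_bigr => j /andP[_ /eqP jl].
  by rewrite scaler_prod -expr_sum jl coefZ coefXn eqxx mulr1.
move=> j; rewrite negb_and negb_forall scaler_prod -expr_sum coefZ coefXn.
case/orP=> [/existsP[k]|/negPf].
  rewrite -eqn0Ngt => /eqP jk.
  by rewrite (bigD1 k) //= jk P0 !mul0r.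
by rewrite eq_sym => ->; rewrite mulr0.
Qed.

Lemma coef_exp_lt (R : comNzRingType) (P : {poly R}) (i l : nat) :
  P`_0 = 0 -> (l < i)%N -> (P ^+ i)`_l = 0.
Proof.
move=> P0 li; rewrite coef_exp_composition // big1 // => j.
case/andP=> /forallP jp /eqP jl.
have: (\sum_(k < i) 1 <= \sum_(k < i) (j k : nat))%N by apply: leq_sum.
by rewrite sum1_card card_ord jl; lia.
Qed.

Lemma dvdXnP (F : fieldType) (M : nat) (P : {poly F}) :
  reflect (forall k, (k < M)%N -> P`_k = 0) ('X^M %| P).
Proof.
apply: (iffP idP) => [/dvdpP[Q ->] k kM|P0]; first by rewrite coefMXn kM.
apply/dvdpP; exists (drop_poly M P).
rewrite -{1}(poly_take_drop M P) [take_poly _ _](_ : _ = 0) ?add0r //.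
by apply/polyP=> k; rewrite coef_take_poly coef0; case: ifP => // /P0.
Qed.

(** Right composition with a series of order exactly 1 is injective, and it
    preserves the order at 0: this allows a congruence to be read off after the
    substitution y = Y(x). *)
Lemma dvdXn_comp (F : fieldType) (M : nat) (U P : {poly F}) :
  U`_0 != 0 -> 'X^M %| P \Po ('X * U) -> 'X^M %| P.
Proof.
move=> U0; elim: M P => [|M IH] P; first by rewrite !expr0 !dvd1p.
move=> PU.
have P0 : P`_0 = 0.
  have := dvdXnP _ _ _ PU 0%N isT.
  by rewrite -!horner_coef0 horner_comp hornerM hornerX mul0r.
have [Q EQ] : exists Q, P = Q * 'X.
  by apply/dvdpP; rewrite -['X]expr1; apply/dvdXnP => -[].
move: PU; rewrite EQ comp_polyM comp_polyX exprS mulrCA.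
rewrite dvdp_mul2l ?polyX_eq0 // Gauss_dvdpl => [/IH QM|].
  by rewrite mulrC dvdp_mul2r ?polyX_eq0.
rewrite coprimep_expl // coprimep_sym -['X]subr0 -polyC0 coprimep_XsubC.
by rewrite /root horner_coef0.
Qed.

(** * The hyperbolic series and the reciprocal series *)

(** Truncation of 2 cosh t - 2 as a series in x = t^2. *)
Definition cosh_poly (M : nat) : {poly rat} :=
  \poly_(j < M.+1) (if j == 0%N then 0 else 2 / ((2 * j)`!)%:R).

(** Truncation of sinh t / t as a series in x = t^2; it stops one degree before
    cosh_poly M so as to be exactly its derivative. *)
Definition sinh_poly (M : nat) : {poly rat} :=
  \poly_(j < M) (1 / ((2 * j + 1)`!)%:R).

(** Coefficients of arcsinh z / (z sqrt(1 + z^2)) in the variable y = 4 z^2. *)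
Definition inv_coef (k : nat) : rat :=
  (-1) ^+ k * ((k`!) ^ 2)%:R / ((2 * k + 1)`!)%:R.

Definition inv_poly (M : nat) : {poly rat} := \poly_(k < M) inv_coef k.

Lemma natr_fact_neq0 k : (k`!)%:R != 0 :> rat.
Proof. by rewrite pnatr_eq0 -lt0n fact_gt0. Qed.

Lemma natrS_neq0 k : (k.+1)%:R != 0 :> rat.
Proof. by rewrite pnatr_eq0. Qed.

Lemma coef0_cosh M : (cosh_poly M)`_0 = 0.
Proof. by rewrite coef_poly. Qed.

Lemma deriv_cosh M : (cosh_poly M)^`() = sinh_poly M.
Proof.
apply/polyP=> k; rewrite coef_deriv !coef_poly ltnS.
case: ifP => _; last by rewrite mul0rn.
rewrite /= (_ : 2 * k.+1 = (2 * k + 1).+1)%N; last by lia.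
rewrite factS natrM -[LHS]mulr_natr.
have -> : (2 * k + 1).+1%:R = 2 * k.+1%:R :> rat by rewrite -natrM; congr _%:R; lia.
by field; rewrite natr_fact_neq0 nat1r natrS_neq0.
Qed.

(** This is (t S)' = cosh t, where the derivative is in t. *)
Lemma dvdXn_sinh_deriv M :
  'X^M %| 2%:P * sinh_poly M + 4%:P * 'X * (sinh_poly M)^`() - 2%:P - cosh_poly M.
Proof.
apply/dvdXnP => k kM; rewrite !coefB coefD -mulrA !coefCM coefXM coefC.
case: k kM => [|k] kM /=; first by by rewrite !coef_poly kM.
rewrite coef_deriv !coef_poly kM ltnS (ltnW kM) /= subr0.
rewrite (_ : 2 * k.+1 + 1 = (2 * k.+1).+1)%N; last by lia.
rewrite factS natrM -[(_ / _) *+ _]mulr_natr.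
have -> : (2 * k.+1).+1%:R = 2 * k.+1%:R + 1 :> rat by rewrite -natrM -natr1.
field; rewrite natr_fact_neq0 /=.
by have := natrS_neq0 (2 * k.+1); rewrite -natr1 natrM -[k.+1%:R]nat1r.
Qed.

Lemma dvdXn_deriv (M : nat) (P : {poly rat}) :
  P`_0 = 0 -> 'X^M %| P^`() -> 'X^(M.+1) %| P.
Proof.
move=> P0 /dvdXnP dP; apply/dvdXnP => -[//|k] kM.
have := dP k kM; rewrite coef_deriv => /eqP.
by rewrite mulrn_eq0 /= => /eqP.
Qed.

(** This is sinh^2 = cosh^2 - 1.  Both sides vanish at 0 and, by the previous
    congruence, have the same derivative. *)
Lemma dvdXn_sinh_sqr M :
  'X^M %| 4%:P * 'X * sinh_poly M ^+ 2 - 4%:P * cosh_poly M - cosh_poly M ^+ 2.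
Proof.
set S := sinh_poly M; set Y := cosh_poly M; set D := (D in _ %| D).
suff: 'X^(M.+1) %| D by apply: dvdp_trans; rewrite exprS dvdp_mulIr.
apply: dvdXn_deriv.
  rewrite -horner_coef0 !hornerE /= ?horner_coef0 coef0_cosh; ring.
have -> : D^`() = 2%:P * S * (2%:P * S + 4%:P * 'X * S^`() - 2%:P - Y).
  rewrite /D !derivB !derivM ?derivXn expr2 ?derivM !derivC derivX deriv_cosh -/S -/Y.
  by rewrite !polyC_natr; ring.
exact/dvdp_mull/dvdXn_sinh_deriv.
Qed.

Lemma inv_coefS k :
  (4 * k + 6)%:R * inv_coef k.+1 = - k.+1%:R * inv_coef k.
Proof.
rewrite /inv_coef (_ : 2 * k.+1 + 1 = (2 * k + 1).+2)%N; last by lia.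
rewrite !factS !natrX !natrM exprS.
have -> : (2 * k + 1).+2%:R = 2 * k%:R + 3 :> rat.
  by rewrite -natrM -natrD; congr _%:R; lia.
have -> : (2 * k + 1).+1%:R = 2 * (k%:R + 1) :> rat.
  by rewrite natr1 -natrM; congr _%:R; lia.
have -> : (4 * k + 6)%:R = 4 * k%:R + 6 :> rat by rewrite natrD natrM.
rewrite -natr1; field.
rewrite natr_fact_neq0 /= natr1 natrS_neq0 /=.
by have := natrS_neq0 (2 * k + 2); rewrite -addn1 -addnA natrD natrM.
Qed.

(** The differential equation (4y + y^2) B' + (2 + y) B = 2 is a restatement of
    the recurrence on the coefficients. *)
Lemma inv_poly_ode M : exists c,
  (4%:P * 'X + 'X ^+ 2) * (inv_poly M)^`() + (2%:P + 'X) * inv_poly M - 2%:P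
  = c * 'X^M.
Proof.
apply/dvdpP/dvdXnP => k kM.
rewrite !coefB coefD !mulrDl !coefD expr2 -!mulrA !coefCM !coefXM !coef_deriv !coefC.
case: k kM => [|k] kM /=.
  by rewrite !coef_poly kM.
have -> : (if k == 0%N then 0 else (inv_poly M)`_k.-1.+1 *+ k.-1.+1)
          = inv_coef k *+ k.
  by case: k kM => [|k] kM /=; rewrite ?mulr0n // coef_poly (ltnW kM).
rewrite !coef_poly kM (ltnW kM) subr0.
rewrite -(mulr_natr (inv_coef k)) -(mulr_natr (inv_coef k.+1)).
have := inv_coefS k; move: (inv_coef k) (inv_coef k.+1) => a b.
rewrite natrD natrM -[k.+1%:R]natr1 => E.
transitivity ((4 * k%:R + 6) * b - (- (k%:R + 1) * a)); last first.
  by rewrite E subrr.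
ring.
Qed.

(** W = B(Y) S satisfies 4 x W' + 2 W = 2, whose only power series solution is 1
    because the coefficients 4k + 2 of the left-hand side do not vanish. *)
Lemma dvdXn_inv_poly_cosh M :
  'X^M %| (inv_poly M \Po cosh_poly M) * sinh_poly M - 1.
Proof.
set S := sinh_poly M; set Y := cosh_poly M; set B0 := _ \Po _.
set B1 := (inv_poly M)^`() \Po Y.
have dB : B0^`() = B1 * S by rewrite deriv_comp deriv_cosh.
have r3 : 'X^M %| (4%:P * Y + Y ^+ 2) * B1 + (2%:P + Y) * B0 - 2%:P.
  have [c /(congr1 (comp_poly Y))] := inv_poly_ode M.
  rewrite comp_polyB comp_polyD !comp_polyM !comp_polyD comp_polyM comp_Xn_poly.
  rewrite comp_polyX !comp_polyC => ->; rewrite comp_Xn_poly.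
  apply/dvdp_mull/dvdp_exp2r; rewrite -['X]expr1; apply/dvdXnP => -[_|//].
  exact: coef0_cosh.
set W := B0 * S.
have rW : 'X^M %| 4%:P * 'X * W^`() + 2%:P * W - 2%:P.
  (* Substitute W' = B'(Y) S^2 + B(Y) S', then use 4xS^2 = 4Y + Y^2, the
     equation of B at Y, and 2S + 4xS' = 2 + Y. *)
  have -> : 4%:P * 'X * W^`() + 2%:P * W - 2%:P =
    (4%:P * 'X * S ^+ 2 - 4%:P * Y - Y ^+ 2) * B1
    + ((4%:P * Y + Y ^+ 2) * B1 + (2%:P + Y) * B0 - 2%:P)
    + B0 * (2%:P * S + 4%:P * 'X * S^`() - 2%:P - Y).
    by rewrite /W derivM dB !polyC_natr; ring.
  apply: dvdp_add; last exact/dvdp_mull/dvdXn_sinh_deriv.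
  by apply: dvdp_add => //; apply/dvdp_mulr/dvdXn_sinh_sqr.
apply/dvdXnP => k kM; have := dvdXnP _ _ _ rW k kM.
rewrite !coefB coefD -mulrA !coefCM coefXM coefC coef1.
case: k kM => [|k] kM /=.
  by move=> /eqP; rewrite mulr0 add0r -{2}[2]mulr1 -mulrBr mulf_eq0 => /eqP.
rewrite coef_deriv !subr0; move: (W`_k.+1) => w.
have -> : 4 * (w *+ k.+1) + 2 * w = w *+ (4 * k.+1 + 2).
  by rewrite -[w *+ k.+1]mulr_natr -[RHS]mulr_natr natrD natrM; ring.
by move=> /eqP; rewrite mulrn_eq0 addn_eq0 andbF => /eqP.
Qed.

(** S = E(Y) and B(Y) S = 1 give (B E)(Y) = 1, hence B E = 1. *)
Lemma inv_eps_conv (eps : nat -> rat) : epsilon_seq eps -> forall N,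
  \sum_(k < N.+1) inv_coef k * eps (N - k)%N = (N == 0%N)%:R.
Proof.
case=> eps0 epsS N.
pose M := N.+1; pose E : {poly rat} := \poly_(i < M) eps i.
have EY : 'X^M %| (E \Po cosh_poly M) - sinh_poly M.
  apply/dvdXnP => l lM; rewrite coefB coef_comp_poly.
  apply/eqP; rewrite subr_eq0; apply/eqP.
  rewrite [in RHS]coef_poly lM.
  transitivity (\sum_(i < M) eps i * (cosh_poly M ^+ i)`_l).
    rewrite (big_ord_widen _ (fun i => E`_i * (cosh_poly M ^+ i)`_l) (size_poly _ _)).
    rewrite big_mkcond; apply: eq_bigr => i _.
    rewrite coef_poly ltn_ord; case: ifP => // /negbT; rewrite -leqNgt => Ei.
    have := nth_default 0 Ei; rewrite coef_poly ltn_ord => ->.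
    by rewrite mul0r.
  case: l lM => [|l] lM.
    rewrite big_ord_recl expr0 coef1 mulr1 eps0 big1 ?addr0 ?divr1 // => i _.
    by rewrite coef_exp_lt ?mulr0 // coef0_cosh.
  rewrite epsS // big_ord_recl expr0 coef1 mulr0 add0r.
  rewrite -(big_mkord xpredT (fun i => eps i.+1 * (cosh_poly M ^+ i.+1)`_l.+1)).
  (* Y^i has order i, so the terms with i > l do not contribute. *)
  rewrite (@big_cat_nat _ _ _ l.+1) //= [X in _ + X]big_nat [X in _ + X]big1 ?addr0; last first.
    by move=> i /andP[li _]; rewrite coef_exp_lt ?mulr0 // coef0_cosh.
  rewrite [RHS]big_add1 /=; apply: eq_big_nat => i /andP[_ il].
  rewrite coef_exp_composition ?coef0_cosh // mulr_sumr.
  apply: eq_bigr => j /andP[/forallP jp _].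
  rewrite [2 ^+ _ * _]mulrC -mulrA; congr (_ * _).
  have -> : 2 ^+ i.+1 = \prod_(k < i.+1) 2 :> rat.
    by rewrite prodr_const card_ord.
  rewrite -prodf_div.
  apply: eq_bigr => k _; rewrite coef_poly.
  by rewrite (leq_trans (ltn_ord _)) ?(leq_trans lM) // eqn0Ngt jp.
have BE : 'X^M %| inv_poly M * E - 1.
  pose U := drop_poly 1 (cosh_poly M).
  have YU : cosh_poly M = 'X * U.
    rewrite -['X]expr1 mulrC -{1}(poly_take_drop 1 (cosh_poly M)).
    rewrite [take_poly _ _](_ : _ = 0) ?add0r //.
    by apply/polyP=> k; rewrite coef_take_poly coef0; case: k => //; rewrite coef0_cosh.
  apply: (@dvdXn_comp _ _ U).
    by rewrite coef_drop_poly coef_poly.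
  rewrite -YU comp_polyB comp_polyM -(polyC1 _) comp_polyC polyC1.
  set B0 := inv_poly M \Po _.
  have -> : B0 * (E \Po cosh_poly M) - 1 =
    B0 * (E \Po cosh_poly M - sinh_poly M) + (B0 * sinh_poly M - 1) by ring.
  by apply: dvdp_add; [exact: dvdp_mull|exact: dvdXn_inv_poly_cosh].
have := dvdXnP _ _ _ BE N (ltnSn N).
rewrite coefB coef1 => /eqP; rewrite subr_eq0 => /eqP <-.
rewrite coefM; apply: eq_bigr => k _; rewrite !coef_poly ltn_ord.
by rewrite ltnS leq_subr.
Qed.

(** * Orders of poles at a prime *)

(** The p-adic valuation of q is at least -a.  Writing q as a quotient with the
    power of p set apart, instead of comparing valuations, covers q = 0 and makes
    the closure properties below plain fraction arithmetic. *)
Definition pole_le (p a : nat) (q : rat) : Prop :=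
  exists t s : int, coprimez p s /\ q = t%:~R / (p%:R ^+ a * s%:~R).

Definition pole_eq (p a : nat) (q : rat) : Prop :=
  exists t s : int,
    [/\ coprimez p t, coprimez p s & q = t%:~R / (p%:R ^+ a * s%:~R)].

Section Poles.

Variables (p : nat) (hp : prime p).

Lemma prime_natr_neq0 : p%:R != 0 :> rat.
Proof. by rewrite pnatr_eq0 -lt0n prime_gt0. Qed.

Lemma coprimez_intr_neq0 (s : int) : coprimez p s -> s%:~R != 0 :> rat.
Proof.
rewrite intr_eq0; apply: contraTneq => ->.
by rewrite coprimezE /= /coprime gcdn0; have := prime_gt1 hp; lia.
Qed.

Lemma pole_eq_le a q : pole_eq p a q -> pole_le p a q.
Proof. by case=> t [s [_ cs ->]]; exists t, s. Qed.

Lemma pole_le0 a : pole_le p a 0.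
Proof. by exists 0, 1; rewrite coprimezE /= coprimen1 mul0r. Qed.

Lemma pole_eq1 : pole_eq p 0 1.
Proof. by exists 1, 1; rewrite coprimezE /= coprimen1.  Qed.

Lemma pole_leS a b q : (a <= b)%N -> pole_le p a q -> pole_le p b q.
Proof.
move=> ab [t [s [cs ->]]]; exists (t * p%:Z ^+ (b - a)), s; split=> //.
rewrite -(subnKC ab) addKn exprD rmorphM rmorphXn /= -pmulrn.
by field; rewrite (coprimez_intr_neq0 _ cs) ?expf_neq0 ?prime_natr_neq0.
Qed.

Lemma pole_leN a q : pole_le p a q -> pole_le p a (- q).
Proof. by move=> [t [s [cs ->]]]; exists (- t), s; rewrite rmorphN mulNr. Qed.

Lemma pole_eqN a q : pole_eq p a q -> pole_eq p a (- q).
Proof.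
move=> [t [s [ct cs ->]]]; exists (- t), s; rewrite rmorphN mulNr; split=> //.
by rewrite coprimezN.
Qed.

Lemma pole_leD a q r : pole_le p a q -> pole_le p a r -> pole_le p a (q + r).
Proof.
move=> [t [s [cs ->]]] [t' [s' [cs' ->]]].
exists (t * s' + t' * s), (s * s'); split; first by rewrite coprimezMr cs.
rewrite rmorphD !rmorphM /=; field.
by rewrite !coprimez_intr_neq0 ?expf_neq0 ?prime_natr_neq0.
Qed.

Lemma pole_leM a b q r :
  pole_le p a q -> pole_le p b r -> pole_le p (a + b) (q * r).
Proof.
move=> [t [s [cs ->]]] [t' [s' [cs' ->]]].
exists (t * t'), (s * s'); split; first by rewrite coprimezMr cs.
rewrite !rmorphM /= exprD; field.
by rewrite !coprimez_intr_neq0 ?expf_neq0 ?prime_natr_neq0.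
Qed.

Lemma pole_eqM a b q r :
  pole_eq p a q -> pole_eq p b r -> pole_eq p (a + b) (q * r).
Proof.
move=> [t [s [ct cs ->]]] [t' [s' [ct' cs' ->]]].
exists (t * t'), (s * s'); split; rewrite ?coprimezMr ?ct ?cs //.
rewrite !rmorphM /= exprD; field.
by rewrite !coprimez_intr_neq0 ?expf_neq0 ?prime_natr_neq0.
Qed.

(** Strict ultrametric inequality: the worse pole wins. *)
Lemma pole_eqD_le a q r :
  pole_eq p a.+1 q -> pole_le p a r -> pole_eq p a.+1 (q + r).
Proof.
move=> [t [s [ct cs ->]]] [t' [s' [cs' ->]]].
exists (t * s' + p%:Z * (t' * s)), (s * s'); split.
- have: coprimez p (t * s') by rewrite coprimezMr ct.
  by rewrite /coprimez addrC [p%:Z * _]mulrC gcdzMDl.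
- by rewrite coprimezMr cs.
rewrite rmorphD !rmorphM /= -pmulrn exprS; field.
by rewrite !coprimez_intr_neq0 ?expf_neq0 ?prime_natr_neq0.
Qed.

Lemma pole_le_sum a (I : finType) (P : pred I) (F : I -> rat) :
  (forall i, P i -> pole_le p a (F i)) -> pole_le p a (\sum_(i | P i) F i).
Proof.
by move=> PF; apply: big_ind => //; [exact: pole_le0 | exact: pole_leD].
Qed.

Lemma padic_val_pole_eq a q : pole_eq p a q -> padic_val p q = - a%:Z.
Proof.
move=> [t [s [ct cs ->]]].
by rewrite -[t%:~R]mul1r -(expr0 p%:R) padic_valE // sub0r.
Qed.

(** * The poles of the coefficients *)

(** In Legendre's formula, floor((2k+1)/p^i) exceeds 2 floor(k/p^i) by at most 1,
    and both vanish as soon as p^i > 2k+1. *)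
Lemma logn_fact_odd k t : (2 * k + 1 < p ^ t.+1)%N ->
  (logn p (2 * k + 1)`! <= 2 * logn p k`! + t)%N.
Proof.
move=> kt; rewrite !logn_fact //.
(* Let both sums of Legendre's formula run over the same range. *)
have -> : (\sum_(1 <= i < k.+1) k %/ p ^ i
           = \sum_(1 <= i < (2 * k + 1).+1) k %/ p ^ i)%N.
  rewrite [RHS](@big_cat_nat _ _ _ k.+1) //=; last by lia.
  rewrite [X in (_ + X)%N]big_nat [X in (_ + X)%N]big1 ?addn0 // => i /andP[ki _].
  by rewrite divn_small // (leq_trans ki) // ltnW // ltn_expl // prime_gt1.
have tle n : (\sum_(1 <= i < n.+1) (i <= t) <= t)%N.
  suff: (\sum_(1 <= i < n.+1) (i <= t) <= minn n t)%N by lia.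
  elim: n => [|n IH]; first by rewrite big_geq.
  by rewrite big_nat_recr //=; lia.
apply: leq_trans (leq_add (leqnn _) (tle (2 * k + 1)%N)).
rewrite big_distrr -big_split /= leq_sum // => i _.
have pi : (0 < p ^ i)%N by rewrite expn_gt0 prime_gt0.
case: (leqP i t) => it.
  rewrite -ltnS ltn_divLR //; have := divn_eq k (p ^ i); have := ltn_pmod k pi.
  by nia.
rewrite divn_small // (leq_trans kt) //.
by rewrite leq_exp2l // prime_gt1.
Qed.

Lemma coprime_fact k : (k < p)%N -> coprime p k`!.
Proof.
move=> kp; rewrite prime_coprime //; elim: k kp => [|k IH] kp.
  by rewrite dvdn1; have := prime_gt1 hp; lia.
rewrite factS Euclid_dvdM // negb_or IH ?(ltnW kp) // andbT.
by apply/negP => /dvdn_leq; lia.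
Qed.

Lemma pole_le_inv_coef k t :
  (2 * k + 1 < p ^ t.+1)%N -> pole_le p t (inv_coef k).
Proof.
move=> /logn_fact_odd; set u := logn p k`!; set v := logn p _ => vu.
have [a ca Ea] := pfactor_coprime hp (fact_gt0 k).
have [b cb Eb] := pfactor_coprime hp (fact_gt0 (2 * k + 1)).
exists ((-1) ^+ k * (a ^ 2 * p ^ (2 * u + t - v))%N%:Z), b.
split; first by rewrite coprimezE.
rewrite /inv_coef Ea Eb -/u -/v intrM rmorph_sign -!pmulrn !(natrX, natrM) exprMn.
have -> : p%:R ^+ (2 * u + t - v) = p%:R ^+ u ^+ 2 * p%:R ^+ t / p%:R ^+ v :> rat.
  apply: (canRL (mulfK _)); first by rewrite expf_neq0 ?prime_natr_neq0.
  by rewrite -exprM -!exprD subnK // mulnC.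
field.
by rewrite !expf_neq0 ?prime_natr_neq0 //= (coprimez_intr_neq0 b).
Qed.

(** Here (2m+1)! = p (p-1)!, and p divides none of (p-1)! and m!. *)
Lemma pole_eq_inv_coef_half m : p = (2 * m + 1)%N -> pole_eq p 1 (inv_coef m).
Proof.
move=> pm.
exists ((-1) ^+ m * (m`! ^ 2)%N%:Z), (2 * m)`!; split.
- rewrite coprimezMr coprimezXr ?coprimezN //; last by rewrite coprimezE /= coprimen1.
  by rewrite coprimezE /= coprimeXr // coprime_fact; lia.
- by rewrite coprimezE coprime_fact; lia.
rewrite /inv_coef pm addn1 factS natrM expr1.
by rewrite intrM rmorph_sign /= -!pmulrn.
Qed.

Lemma ltn_bernoulli m t : (0 < m)%N -> (1 + t.+2 * (2 * m) < (2 * m + 1) ^ t.+2)%N.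
Proof.
move=> m0; elim: t => [|t IH]; first by rewrite expnS expn1; nia.
by rewrite expnS; nia.
Qed.

(** With t = floor((k-1)/m) one has k <= (t+1) m, so 2k+1 <= 1 + (t+1)(p-1),
    which is at most p^(t+1); equality forces t = 0 and k = m. *)
Lemma pole_le_inv_coef_off m k : p = (2 * m + 1)%N -> (0 < k)%N -> k != m ->
  pole_le p (k.-1 %/ m) (inv_coef k).
Proof.
move=> pm k0 km; have m0 : (0 < m)%N by have := prime_gt1 hp; lia.
apply: pole_le_inv_coef.
have := ltn_ceil k.-1 m0; case: (k.-1 %/ m)%N => [|t] kt; first by rewrite expn1; lia.
by rewrite pm; have := ltn_bernoulli m t m0; lia.
Qed.

Lemma pole_le_inv_coef_floor m k :
  p = (2 * m + 1)%N -> pole_le p (k %/ m) (inv_coef k).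
Proof.
move=> pm; have m0 : (0 < m)%N by have := prime_gt1 hp; lia.
have [->|k0] := posnP k.
  by rewrite div0n; apply: pole_le_inv_coef; have := prime_gt1 hp; rewrite expn1; lia.
have [->|km] := eqVneq k m.
  by rewrite divnn m0; exact/pole_eq_le/pole_eq_inv_coef_half.
apply: pole_leS (pole_le_inv_coef_off m k pm k0 km).
by apply: leq_div2r; lia.
Qed.

Lemma divn_add_leq a b m : (0 < m)%N -> (a %/ m + b %/ m <= (a + b) %/ m)%N.
Proof. by move=> m0; rewrite leq_divRL // mulnDl leq_add // leq_trunc_div. Qed.

(** * Valuations of epsilon *)

Lemma eps_rec eps N : epsilon_seq eps ->
  eps N.+1 = - \sum_(k < N.+1) inv_coef k.+1 * eps (N - k)%N.
Proof.
move=> heps; have := inv_eps_conv eps heps N.+1.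
rewrite big_ord_recl subn0 mul1r => /eqP.
by rewrite addr_eq0 => /eqP.
Qed.

Lemma pole_le_eps eps m N : epsilon_seq eps -> p = (2 * m + 1)%N ->
  pole_le p (N %/ m) (eps N).
Proof.
move=> heps pm; have m0 : (0 < m)%N by have := prime_gt1 hp; lia.
elim/ltn_ind: N => -[|N] IH.
  by rewrite div0n (proj1 heps); exact/pole_eq_le/pole_eq1.
rewrite eps_rec //; apply/pole_leN/pole_le_sum => k _.
have kN := ltn_ord k.
apply: pole_leS (pole_leM _ _ _ _ (pole_le_inv_coef_floor m k.+1 pm) (IH (N - k)%N _)).
  by rewrite (leq_trans (divn_add_leq _ _ _ m0)) // leq_div2r //; lia.
by lia.
Qed.

(** The terms k <> m of the recursion have poles of order at most
    floor((k-1)/m) + floor((nm-k)/m) <= n-1, and the term k = m has a pole of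
    order exactly 1 + (n-1). *)
Lemma pole_eq_eps eps m n : epsilon_seq eps -> p = (2 * m + 1)%N ->
  pole_eq p n (eps (n * m)%N).
Proof.
move=> heps pm; have m0 : (0 < m)%N by have := prime_gt1 hp; lia.
elim: n => [|n IH]; first by rewrite mul0n (proj1 heps); exact: pole_eq1.
have -> : (n.+1 * m = (n * m + m.-1).+1)%N by rewrite mulSn; lia.
have mN : (m.-1 < (n * m + m.-1).+1)%N by lia.
rewrite eps_rec // (bigD1 (Ordinal mN)) //= prednK // addnK.
apply/pole_eqN/pole_eqD_le.
  exact: pole_eqM (pole_eq_inv_coef_half m pm) IH.
apply: pole_le_sum => k /eqP km.
have km' : k.+1 != m.
  by apply/eqP => E; apply: km; apply: val_inj => /=; lia.
have kN := ltn_ord k.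
apply: pole_leS (pole_leM _ _ _ _ (pole_le_inv_coef_off m k.+1 pm isT km')
  (pole_le_eps eps m _ heps pm)) => /=.
rewrite (leq_trans (divn_add_leq _ _ _ m0)) // subnKC; last by lia.
by rewrite divnMDl // divn_small ?addn0 //; lia.
Qed.
End Poles.

Theorem theorem5p4 (eps : nat -> rat) (heps : epsilon_seq eps)
    (p : nat) (hp : prime p) (hodd : odd p) (n : nat) :
  padic_val p (eps (n * (p - 1) %/ 2)%N) = - n%:Z.
Proof.
pose m := p./2; have pm : p = (2 * m + 1)%N.
  by rewrite -[LHS]odd_double_half hodd /m; lia.
rewrite {2}pm addnK mulnCA mulKn //.
exact/padic_val_pole_eq/pole_eq_eps.
Qed.
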